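(* Let $\pi$ be a non-identity permutation of size $n$, and let $D$ be a nonempty finite set of positive integers. Let $i$ be the largest element of $D$ such that $i-1\notin D$, and write $D = D' \sqcup [i, i + l - 1]$ with $l\ge1$ and $D'=\{x\in D : x<i\}$. Suppose $\pi$ has a decreasing subsequence of length $l+1$, and let $k$ be the largest index such that $\pi_{[k, n]}$ has a decreasing subsequence of length $l+1$. Then $\operatorname{ls}_D(\pi) \neq 0$ if and only if $i \leq \operatorname{ls}_{D'}(\pi_{[k]})$.
   Context: Permutations of $[n]=\{1,\dots,n\}$ are written as words $\pi(1)\cdots\pi(n)$; $[a,b]=\{a,a+1,\dots,b\}$. For $I=\{i_1<\cdots<i_r\}\subseteq[n]$, $\pi_I=\pi(i_1)\cdots\pi(i_r)$, so $\pi_{[k]}=\pi(1)\cdots\pi(k)$ and $\pi_{[k,n]}=\pi(k)\cdots\pi(n)$. The descent set of a sequence $\sigma$ of length $m$ is $\operatorname{Des}(\sigma)=\{j\in[m-1] : \sigma(j)>\sigma(j+1)\}$. For a set $D$ of positive integers and a sequence $\sigma$ of distinct numbers, $\operatorname{ls}_D(\sigma)$ is the maximum length of a subsequence of $\sigma$ whose descent set is exactly $D$ (equal to $0$ if there is none). *)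

(* Defs.v *)
From mathcomp Require Import all_boot all_fingroup.
From mathcomp Require Import finmap.

Set Implicit Arguments.
Unset Strict Implicit.
Unset Printing Implicit Defensive.

Local Open Scope nat_scope.
Local Open Scope fset_scope.

Definition nat_itv (a b : nat) : {fset nat} :=
  [fset j in iota a (b.+1 - a)].

(* The elements of 'I_n stand for 1, ..., n through i |-> i.+1, both as
   positions and as values; index sets are sets of 1-based positions. *)
Definition perm_subword (n : nat) (pi : 'S_n) (I : {fset nat}) : seq nat :=
  [seq (pi i).+1 | i : 'I_n <- enum 'I_n & i.+1 \in I].

(* Descents are 1-based: the j-th letter of s is nth 0 s j.-1. *)
Definition Des (s : seq nat) : {fset nat} :=
  [fset j in iota 1 (size s).-1 | nth 0 s j.-1 > nth 0 s j].

(* The subsequences of s are the mask m s, with m : (size s).-tuple bool;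
   the maximum over an empty family is 0. *)
Definition ls (D : {fset nat}) (s : seq nat) : nat :=
  \max_(m : (size s).-tuple bool | Des (mask m s) == D) size (mask m s).

Definition has_decr_subseq (s : seq nat) (m : nat) : Prop :=
  exists t : seq nat, [/\ subseq t s, sorted gtn t & size t = m].

(* Main.v *)
Require Import Defs.
From mathcomp Require Import all_boot all_fingroup.
From mathcomp Require Import finmap zify.

(** The argument uses only the order of the letters, so it is carried out for
    an arbitrary word [s].

    A word [t] with descent set [D] splits at its [i]-th letter [x] as
    [p ++ x :: v]: the descents of [rcons p x] are the elements of [D] below
    [i], that is [D'], and [x :: v] begins with a decreasing run of length
    [l + 1].  If [t] occurs in [s], then [x] sits at a position from which a
    decreasing subsequence of length [l + 1] starts, hence at position at most
    [k], so [rcons p x] occurs in the first [k] letters of [s]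
    ([subseq_Des_prefix]).

    Conversely, let [rcons p z], of length [i] and with descent set [D'], occur
    in the first [k] letters of [s].  By maximality of [k], the decreasing
    subsequence of length [l + 1] found from position [k] on begins with the
    [k]-th letter [y] itself; write it [y :: v].  If [z > y], then
    [p ++ z :: v] has descent set [D].  If [z <= y], the last letter [z] is
    replaced by [y]: since [i - 1] is not in [D], the last letter of [p], if
    any, is at most [z], hence at most [y], and [p ++ y :: v] has
    descent set [D] ([subseq_Des_extend]). *)

Set Implicit Arguments.
Unset Strict Implicit.
Unset Printing Implicit Defensive.

Local Open Scope nat_scope.

Lemma mem_nat_itv a b j : (j \in nat_itv a b) = (a <= j <= b).
Proof. by rewrite /nat_itv !inE /= mem_iota; lia. Qed.

Lemma perm_subword_itv (n : nat) (pi : 'S_n) a b : 0 < a ->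
  perm_subword pi (nat_itv a b)
  = drop a.-1 (take b [seq (pi j).+1 | j <- enum 'I_n]).
Proof.
move=> a0; rewrite /perm_subword -map_take -map_drop; congr map.
apply: (inj_map val_inj); rewrite map_drop map_take val_enum_ord.
rewrite (eq_filter (a2 := preim (@nat_of_ord n) (fun m => a <= m.+1 <= b))).
  2: by move=> j; rewrite /= mem_nat_itv.
rewrite -filter_map val_enum_ord take_iota drop_iota.
apply: (irr_sorted_eq ltn_trans ltnn).
- by apply: (sorted_filter ltn_trans); apply: iota_ltn_sorted.
- exact: iota_ltn_sorted.
by move=> j; rewrite mem_filter !mem_iota; lia.
Qed.

Lemma mem_Des (s : seq nat) (j : nat) :
  (j \in Des s) = (0 < j < size s) && (nth 0 s j < nth 0 s j.-1).
Proof. by rewrite /Des !inE /= mem_iota; lia. Qed.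

Lemma mem_Des_take m s j : (j \in Des (take m s)) = (j < m) && (j \in Des s).
Proof.
rewrite !mem_Des size_take_min.
case: (ltnP j m) => jm /=; last by lia.
by rewrite !nth_take //; lia.
Qed.

(** The letter [x] is shared by both words: the comparison of [x] with the
    letter before it belongs to [rcons p x], the one with the letter after it
    to [x :: v]. *)
Lemma mem_Des_cat p x v j :
  (j \in Des (p ++ x :: v))
  = if j <= size p then j \in Des (rcons p x) else j - size p \in Des (x :: v).
Proof.
rewrite !mem_Des size_cat size_rcons /= !nth_cat !nth_rcons.
case: (leqP j (size p)) => jp.
  case: (ltnP j (size p)) => jp'.
    have -> : j.-1 < size p by lia.
    by lia.
  have -> : j = size p by lia.
  rewrite subnn eqxx /=; case: (posnP (size p)) => [->//|p0].
  have -> : (size p).-1 < size p by lia.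
  by lia.
have -> : (j < size p) = false by lia.
have -> : (j.-1 < size p) = false by lia.
have -> : (j - size p).-1 = j.-1 - size p by lia.
by congr andb; lia.
Qed.

Lemma mem_Des_decr s j : sorted gtn s -> (j \in Des s) = (0 < j < size s).
Proof.
move=> /(sortedP 0) ss; rewrite mem_Des andb_idr //.
by case: j => // j /= js; apply: ss.
Qed.

(** A nonzero bound on [ls] is attained by an actual subsequence; zero is
    excluded because [ls] is also [0] when there is none. *)
Lemma leq_lsP D s m : 0 < m ->
  m <= ls D s <-> exists t : seq nat, [/\ subseq t s, Des t = D & m <= size t].
Proof.
case: m => // m _; split=> [lm|[t [/subseqP[b bs ->] Dt mt]]].
  have /existsP[b /andP[/eqP Db mb]] : [exists b : (size s).-tuple bool,
      (Des (mask b s) == D) && (m < size (mask b s))].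
    apply/contraT; rewrite negb_exists => /forallP nb.
    move: lm; rewrite ltnNge => /negP[]; apply/bigmax_leqP => b Db.
    by move: (nb b); rewrite Db /= -leqNgt.
  by exists (mask b s); split=> //; apply: mask_subseq.
have bs' : size b == size s by apply/eqP.
apply: leq_trans mt _.
by apply: (@leq_bigmax_cond _ _ _ (Tuple bs')); rewrite /= Dt.
Qed.

Lemma subseq_cat_consP (T : eqType) (p v s : seq T) x :
  subseq (p ++ x :: v) s ->
  exists s1 s2, [/\ s = s1 ++ x :: s2, subseq p s1 & subseq v s2].
Proof.
elim: s p => [|y s IH] [|a p] //=.
  case: eqP => [<- sv|_ sv]; first by exists [::], s.
  have [s1 [s2 [-> _ s2v]]] := IH [::] sv.
  by exists (y :: s1), s2; split=> //; apply: sub0seq.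
case: eqP => [<-|ya] sv.
  have [s1 [s2 [-> p1 v2]]] := IH p sv.
  by exists (a :: s1), s2; rewrite /= eqxx.
have [s1 [s2 [-> p1 v2]]] := IH (a :: p) sv.
by exists (y :: s1), s2; split=> //=; case: eqP ya.
Qed.

Section LastDescentRun.

Variables (s : seq nat) (D : {fset nat}) (i l k : nat).
Let D' := [fset x in D | x < i]%fset.

Hypothesis i_gt0 : 0 < i.
Hypothesis l_gt0 : 0 < l.
Hypothesis D_run : forall j : nat, (j \in D) = (j \in D') || (i <= j < i + l).

Hypothesis k_max : forall k', 1 <= k' <= size s ->
  has_decr_subseq (drop k'.-1 s) l.+1 -> k' <= k.

Let mem_D' (j : nat) : (j \in D') = (j \in D) && (j < i).
Proof. by rewrite !inE. Qed.

(** The prefix of length [i] of [t] ends where a decreasing run of length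
    [l + 1] starts, so the maximality of [k] confines it to [take k s]. *)
Lemma subseq_Des_prefix (t : seq nat) : subseq t s -> Des t = D ->
  exists u : seq nat, [/\ subseq u (take k s), Des u = D' & i <= size u].
Proof.
move=> ts Dt.
have szt : i + l <= size t.
  have : (i + l).-1 \in Des t by rewrite Dt D_run; lia.
  by rewrite mem_Des; lia.
have it : i.-1 < size t by lia.
exists (take i t); split; last by rewrite size_take_min; lia.
  pose x := nth 0 t i.-1.
  have tE : t = take i.-1 t ++ x :: drop i t.
    by rewrite -[i in drop i _](prednK i_gt0) -drop_nth ?cat_take_drop.
  have [s1 [s2 [sE p1 v2]]] : exists s1 s2,
      [/\ s = s1 ++ x :: s2, subseq (take i.-1 t) s1 & subseq (drop i t) s2].
    by apply: subseq_cat_consP; rewrite -tE.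
  have s1k : (size s1).+1 <= k.
    apply: k_max; first by rewrite sE size_cat /=; lia.
    exists (take l.+1 (drop i.-1 t)); split.
    - rewrite sE /= drop_size_cat // (drop_nth 0) // prednK //= eqxx.
      exact: subseq_trans (take_subseq _ _) v2.
    - apply/(sortedP 0) => j; rewrite size_take_min size_drop => jl.
      rewrite !nth_take ?nth_drop; try lia.
      have : i.-1 + j.+1 \in Des t by rewrite Dt D_run; lia.
      by rewrite mem_Des => /andP[_]; rewrite addnS.
    - by rewrite size_take_min size_drop; lia.
  have -> : take i t = take i.-1 t ++ [:: x].
    by rewrite cats1 -take_nth // prednK.
  rewrite sE take_cat ltnNge ltnW //= cat_subseq //.
  have -> : k - size s1 = (k - size s1).-1.+1 by lia.
  by rewrite /= eqxx sub0seq.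
by apply/fsetP => j; rewrite mem_Des_take Dt mem_D' andbC.
Qed.

Hypothesis i_start : i.-1 \notin D.
Hypothesis k_bounds : 1 <= k <= size s.

(** The letter at which the two pieces are glued is the larger of the [i]-th
    letter of [u] and the [k]-th letter of [s]: this creates no descent at
    [i - 1] and keeps the run after it decreasing. *)
Lemma subseq_Des_extend (u : seq nat) : has_decr_subseq (drop k.-1 s) l.+1 ->
  subseq u (take k s) -> Des u = D' -> i <= size u ->
  exists t : seq nat, subseq t s /\ Des t = D.
Proof.
move=> [d [ds sd szd]] us Du iu.
have k1 : k.-1 < size s by lia.
have k0 : 0 < k by lia.
set y := nth 0 s k.-1; set s0 := take k.-1 s; set s' := drop k s.
have sE : s = s0 ++ y :: s'.
  by rewrite /s' -[k in drop k _](prednK k0) -drop_nth ?cat_take_drop.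
have tkE : take k s = rcons s0 y by rewrite -take_nth // prednK.
(* By maximality of k, the decreasing subsequence starts at position k. *)
have [v dE vs'] : exists2 v, d = y :: v & subseq v s'.
  move: ds; rewrite (drop_nth 0) // prednK // -/y -/s'.
  case: d sd szd => // a v sd szd /=; case: eqP => [-> sv|_ ds].
    by exists v.
  have szk : l.+1 <= size s - k.
    by rewrite -szd -size_drop; exact: size_subseq ds.
  have : k.+1 <= k by apply: k_max; [lia | exists (a :: v)].
  by rewrite ltnn.
pose p := take i.-1 u; pose z := nth 0 u i.-1.
have uE : take i u = rcons p z by rewrite -take_nth ?prednK.
have szp : size p = i.-1 by rewrite size_take_min; lia.
have pz : subseq (rcons p z) (rcons s0 y).
  by rewrite -uE -tkE; apply: subseq_trans (take_subseq _ _) us.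
have ps : subseq p s0.
  have := pz; rewrite -cats1 => /subseq_cat_consP[s1 [s2 [s0E p1 _]]].
  apply: subseq_trans p1 _.
  have : prefix s1 s0.
    have -> : s0 = take (size s0) (rcons s0 y).
      by rewrite -cats1 take_size_cat.
    rewrite s0E take_cat; case: ltnP; last by rewrite prefix_prefix.
    by move: (congr1 size s0E); rewrite size_rcons size_cat /=; lia.
  by move=> /prefixP[s3 ->]; apply: prefix_subseq.
have Dpz : Des (rcons p z) = D'.
  apply/fsetP => j; rewrite -uE mem_Des_take Du mem_D'.
  by case: (j < i); rewrite ?andbF ?andbT.
pose x := maxn z y.
exists (p ++ x :: v); split.
  rewrite /x; case: (leqP z y) => zy.
    by rewrite sE; apply: cat_subseq => //=; rewrite eqxx.
  by rewrite -cat_rcons -[s](cat_take_drop k) tkE; apply: cat_subseq.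
have sxv : sorted gtn (x :: v).
  move: sd; rewrite dE /=; case: (v) => //= a w /andP[ay ->].
  by rewrite andbT /x; apply: leq_trans ay (leq_maxr _ _).
have szv : size v = l by move: szd; rewrite dE /= => -[].
have Dpx : Des (rcons p x) = D'.
  rewrite -Dpz; apply/fsetP => j; rewrite !mem_Des !size_rcons !nth_rcons szp.
  case: (ltngtP j i.-1) => [ji|ji|ji]; last 1 first.
  (* i - 1 is not a descent before z, hence not before the larger x. *)
  - have : i.-1 \notin Des (rcons p z) by rewrite Dpz mem_D' (negPf i_start).
    rewrite mem_Des size_rcons szp !nth_rcons szp ltnn eqxx ji.
    case: (posnP i.-1) => [-> //|i1].
    have -> : i.-2 < i.-1 by lia.
    by rewrite /x; lia.
  - by have -> : j.-1 < i.-1 by lia.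
  - by lia.
apply/fsetP => j; rewrite mem_Des_cat szp Dpx D_run mem_Des_decr //= szv.
by rewrite mem_D'; case: (leqP j i.-1) => ji; lia.
Qed.

End LastDescentRun.

Theorem proposition4p10 (n : nat) (pi : 'S_n) (D D' : {fset nat})
    (i l k : nat) :
  pi <> 1%g ->
  D <> fset0 ->
  (forall x, x \in D -> 0 < x) ->
  (* i is the largest element of D with i - 1 not in D *)
  i \in D -> i.-1 \notin D ->
  (forall j, j \in D -> j.-1 \notin D -> j <= i) ->
  (* D is the disjoint union of D' and [i, i + l - 1] *)
  1 <= l ->
  D' = [fset x in D | x < i]%fset ->
  D = (D' `|` nat_itv i (i + l - 1))%fset ->
  [disjoint D' & nat_itv i (i + l - 1)]%fset ->
  has_decr_subseq (perm_subword pi (nat_itv 1 n)) l.+1 ->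
  (* k is the largest index such that pi_[k, n] has a decreasing
     subsequence of length l + 1 *)
  1 <= k <= n ->
  has_decr_subseq (perm_subword pi (nat_itv k n)) l.+1 ->
  (forall k', 1 <= k' <= n ->
     has_decr_subseq (perm_subword pi (nat_itv k' n)) l.+1 -> k' <= k) ->
  (ls D (perm_subword pi (nat_itv 1 n)) <> 0 <->
  i <= ls D' (perm_subword pi (nat_itv 1 k))).

Proof.
move=> _ _ D0 iD iN _ l1 D'E DE _ _ kn hk kmax.
pose s := [seq (pi j).+1 | j <- enum 'I_n].
have szs : size s = n by rewrite size_map size_enum_ord.
have s1n : perm_subword pi (nat_itv 1 n) = s.
  by rewrite perm_subword_itv //= drop0 take_oversize ?szs.
have s1k : perm_subword pi (nat_itv 1 k) = take k s.
  by rewrite perm_subword_itv //= drop0.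
have skn k' : 1 <= k' -> perm_subword pi (nat_itv k' n) = drop k'.-1 s.
  by move=> k'1; rewrite perm_subword_itv // take_oversize ?szs.
have i0 := D0 _ iD.
have kb : 1 <= k <= size s by rewrite szs.
have km k' : 1 <= k' <= size s ->
    has_decr_subseq (drop k'.-1 s) l.+1 -> k' <= k.
  by rewrite szs => k'n; rewrite -skn; [apply: kmax | lia].
have Drun (j : nat) :
    (j \in D) = (j \in [fset x in D | x < i]%fset) || (i <= j < i + l).
  by rewrite {1}DE D'E in_fsetU mem_nat_itv; congr orb; lia.
rewrite s1n s1k D'E; split.
  move=> /eqP; rewrite -lt0n => /(@leq_lsP D s 1 isT)[t [ts Dt _]].
  apply/(leq_lsP _ _ i0).
  exact: (subseq_Des_prefix i0 l1 Drun km ts Dt).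
move=> /(leq_lsP _ _ i0)[u [us Du iu]].
have hk' : has_decr_subseq (drop k.-1 s) l.+1 by rewrite -skn //; lia.
have [t [ts Dt]] := subseq_Des_extend i0 l1 Drun km iN kb hk' us Du iu.
apply/eqP; rewrite -lt0n; apply/(@leq_lsP D s 1 isT); exists t; split=> //.
by move: iD; rewrite -Dt mem_Des; lia.
Qed.
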